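(* Let $(\alpha,\gamma)$ be a pair of real-valued random variables, and let $\xi$ be a real-valued random variable independent of $(\alpha,\gamma)$ having a density function $f_\xi$ with respect to Lebesgue measure. Put $\beta:=\gamma+\xi$ and assume that $\mathbb{P}(\alpha\ne0)=1$, $\mathbb{P}(|\alpha|\ne1)>0$, and there is no constant $c\in\mathbb{R}$ with $\alpha(c-\beta)=c$ almost surely. Then any bounded solution $y:\mathbb{R}\to\mathbb{R}$ of the equation $$y(x)=\int_{\mathbb{R}}\varphi(x-t)\,f_\xi(t)\,\mathrm{d}t,\quad x\in\mathbb{R},\qquad\text{where }\ \varphi(x):=\mathbb{E}\{y(\alpha(x-\gamma))\},$$ is uniformly continuous on $\mathbb{R}$.
   Context: The displayed equation is the form taken by $y(x)=\mathbb{E}\{y(\alpha(x-\beta))\}$ when $\beta=\gamma+\xi$. $\mathbb{E}$ denotes expectation. A bounded solution is a bounded function $y$ satisfying the equation for every $x\in\mathbb{R}$; it is assumed Borel measurable so that the expectation makes sense, while continuity of $y$ is not assumed a priori. No restriction is placed on $\mathbb{E}\{\ln|\alpha|\}$. *)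

(* Defs.v *)
From HB Require Import structures.
From mathcomp Require Import all_boot all_order all_algebra.
From mathcomp Require Import all_classical all_reals all_analysis.

Set Implicit Arguments.
Unset Strict Implicit.
Unset Printing Implicit Defensive.

Import Order.TTheory GRing.Theory Num.Theory.
Import numFieldNormedType.Exports.

Local Open Scope classical_set_scope.
Local Open Scope ring_scope.

(* [X] and [Y] are plain functions so that [X] can be a pair
   [fun w => (a w, b w)]; they are meant to be measurable. *)
Definition independent_rv (d d1 d2 : measure_display) (T : measurableType d)
    (T1 : measurableType d1) (T2 : measurableType d2) (R : realType)
    (P : probability T R) (X : T -> T1) (Y : T -> T2) : Prop :=
  forall (A : set T1) (B : set T2), measurable A -> measurable B ->
    P (X @^-1` A `&` Y @^-1` B) = (P (X @^-1` A) * P (Y @^-1` B))%E.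

Definition has_density (d : measure_display) (T : measurableType d)
    (R : realType) (P : probability T R) (X : {RV P >-> R}) (f : R -> R) : Prop :=
  [/\ measurable_fun [set: R] f,
      (forall t, 0 <= f t) &
      forall B : set R, measurable B ->
        distribution P X B = (\int[lebesgue_measure]_(t in B) (f t)%:E)%E].

(* The expectation is finite whenever [y] is bounded and Borel, so that [fine]
   loses nothing there. *)
Definition varphi (d : measure_display) (T : measurableType d) (R : realType)
    (P : probability T R) (alpha gamma : {RV P >-> R}) (y : R -> R) (x : R) : R :=
  fine ('E_P[fun w => y (alpha w * (x - gamma w))]).

Definition bounded_solution (d : measure_display) (T : measurableType d)
    (R : realType) (P : probability T R) (alpha gamma : {RV P >-> R})
    (f : R -> R) (y : R -> R) : Prop :=
  [/\ measurable_fun [set: R] y,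
      bounded_fun y &
      forall x, y x =
        \int[lebesgue_measure]_t (varphi alpha gamma y (x - t) * f t)].

(* Main.v *)
(* [y] is the convolution of [varphi] with [f_xi].  As [varphi] is bounded and
   Borel and [f_xi] is integrable, [|y x - y z|] is at most [sup |varphi|] times
   the L1-distance between [f_xi] and its translate by [z - x], which tends to
   [0] with [z - x].  For indicators of compact sets that last fact follows from
   outer regularity of Lebesgue measure; inner regularity and density of simple
   functions extend it to all integrable functions. *)
Require Import Defs.
From HB Require Import structures.
From mathcomp Require Import all_boot all_order all_algebra.
From mathcomp Require Import all_classical all_reals all_analysis.
From mathcomp Require Import measurable_realfun.
From mathcomp Require Import ring.

Set Implicit Arguments.
Unset Strict Implicit.
Unset Printing Implicit Defensive.

Import Order.TTheory GRing.Theory Num.Theory.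
Import numFieldNormedType.Exports.

Local Open Scope classical_set_scope.
Local Open Scope ring_scope.

(** * Translation invariance of Lebesgue measure and of the integral *)

Section translation.
Context {R : realType}.
Local Notation mu := (@lebesgue_measure R).

Lemma measurable_shift (s : R) : measurable_fun [set: R] (fun t : R => t + s).
Proof. exact: (measurable_funD (@measurable_id _ _ _) (measurable_cst s)). Qed.

(** The pushforward of [mu] under the shift gives every half-open interval its length, and Lebesgue
    measure is the only measure that does. *)
Lemma lebesgue_measure_shift (s : R) (A : set R) : measurable A ->
  mu ((fun t => t + s) @^-1` A) = mu A.
Proof.
move=> mA.
pose phi : measurableTypeR R -> measurableTypeR R := fun t => t + s.
have mphi : measurable_fun setT phi := measurable_shift s.
have [nu nuE] : exists nu : {measure set (measurableTypeR R) -> \bar R},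
    forall B, nu B = mu (phi @^-1` B).
  (* the measure structure of [pushforward] depends on a measurability proof *)
  by unshelve eexists (pushforward mu phi : {measure set _ -> \bar R}).
apply/esym; rewrite -[RHS]nuE.
apply: (lebesgue_measure_unique (mu := nu)) mA.
move=> _ [[a b] _ <-] /=; rewrite nuE.
have -> : phi @^-1` `]a, b] = `](a - s), (b - s)]%classic.
  apply/seteqP; split=> x /=; rewrite !in_itv /= /phi.
    by move=> /andP[ax xb]; rewrite ltrBlDr ax lerBrDr xb.
  by rewrite ltrBlDr lerBrDr.
by rewrite !lebesgue_measure_itv /= !lte_fin ltrD2r -!EFinB opprB addrA subrK.
Qed.

Lemma ge0_integral_shift (s : R) (g : R -> \bar R) :
  measurable_fun [set: R] g -> (forall t, 0 <= g t)%E ->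
  (\int[mu]_t g (t + s)%R = \int[mu]_t g t)%E.
Proof.
move=> mg g0.
have := @ge0_integral_pushforward _ _ (measurableTypeR R)
  (measurableTypeR R) R _ (measurable_shift s) mu setT g.
rewrite preimage_setT => <- //.
apply: eq_measure_integral; first exact: measurable_shift.
by move=> mshift A mA _; exact: lebesgue_measure_shift.
Qed.

Lemma integral_shift (s : R) (g : R -> \bar R) :
  measurable_fun [set: R] g ->
  (\int[mu]_t g (t + s)%R = \int[mu]_t g t)%E.
Proof.
move=> mg; rewrite integralE [RHS]integralE; congr (_ - _)%E.
  rewrite -(ge0_integral_shift s (measurable_funepos mg) (funepos_ge0 g)).
  by rewrite (funepos_comp g (fun t => t + s)).
rewrite -(ge0_integral_shift s (measurable_funeneg mg) (funeneg_ge0 g)).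
by rewrite (funeneg_comp g (fun t => t + s)).
Qed.

(** * Continuity of translations in the L1 norm *)

Lemma measurable_fun_EFin_norm (h : R -> R) : measurable_fun [set: R] h ->
  measurable_fun [set: R] (fun t => `|h t|%:E).
Proof. by move=> mh; apply/measurable_EFinP; exact: measurableT_comp. Qed.

Lemma integral_normD_le (f g : R -> R) :
  measurable_fun [set: R] f -> measurable_fun [set: R] g ->
  (\int[mu]_t `|f t + g t|%:E <=
   \int[mu]_t `|f t|%:E + \int[mu]_t `|g t|%:E)%E.
Proof.
move=> mf mg.
rewrite -ge0_integralD//; [|exact: measurable_fun_EFin_norm..].
apply: ge0_le_integral => //.
- exact: measurable_fun_EFin_norm (measurable_funD mf mg).
- by apply: emeasurable_funD; exact: measurable_fun_EFin_norm.
- by move=> t _; rewrite -EFinD lee_fin ler_normD.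
Qed.

(** The integral stays in [\bar R]: a real-valued one would turn an infinite distance into [0]. *)
Definition L1_translation_continuous (h : R -> R) := forall e : R, 0 < e ->
  \forall s \near (0 : R), (\int[mu]_t `|h (t + s) - h t|%:E <= e%:E)%E.

Lemma measurable_fun_shiftB (h : R -> R) (s : R) :
  measurable_fun [set: R] h ->
  measurable_fun [set: R] (fun t => h (t + s) - h t).
Proof.
move=> mh; apply: measurable_funB => //.
exact: (measurableT_comp mh (measurable_shift s)).
Qed.

Lemma L1_translation_continuous0 : L1_translation_continuous (fun=> 0).
Proof.
move=> e e0; near=> s; rewrite integral0_eq ?lee_fin ?ltW// => t _.
by rewrite subrr normr0.
Unshelve. all: by end_near. Qed.

Lemma L1_translation_continuousD (f g : R -> R) :
  measurable_fun [set: R] f -> measurable_fun [set: R] g ->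
  L1_translation_continuous f -> L1_translation_continuous g ->
  L1_translation_continuous (fun t => f t + g t).
Proof.
move=> mf mg cf cg e e0; have e20 : 0 < e / 2 by rewrite divr_gt0.
near=> s.
under eq_integral do rewrite opprD addrACA.
rewrite (splitr e) EFinD.
apply: le_trans (integral_normD_le _ _) _; [exact: measurable_fun_shiftB..|].
by apply: leeD; near: s; [exact: cf|exact: cg].
Unshelve. all: by end_near. Qed.

Lemma L1_translation_continuousZ (c : R) (f : R -> R) :
  measurable_fun [set: R] f ->
  L1_translation_continuous f -> L1_translation_continuous (fun t => c * f t).
Proof.
move=> mf cf e e0; have c0 : 0 < `|c| + 1 by rewrite ltr_wpDl.
have ec0 : 0 < e / (`|c| + 1) by rewrite divr_gt0.
near=> s.
under eq_integral do rewrite -mulrBr normrM EFinM.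
rewrite ge0_integralZl_EFin//; last first.
  apply/measurable_EFinP; apply: measurableT_comp => //.
  exact: measurable_fun_shiftB.
apply: (@le_trans _ _ (`|c|%:E * (e / (`|c| + 1))%:E)%E).
  by apply: lee_pmul => //; [exact: integral_ge0|near: s; exact: cf].
rewrite -EFinM lee_fin mulrCA ler_piMr// ?ltW//.
by rewrite ltr_pdivrMr// mul1r ltrDl.
Unshelve. all: by end_near. Qed.

(** Closure under L1 limits by an [e / 3] argument: by translation invariance, the shifted error
    [h (t + s) - g (t + s)] has the same norm as [h - g], whatever [s] is. *)
Lemma L1_translation_continuous_approx (h : R -> R) :
  measurable_fun [set: R] h ->
  (forall e : R, 0 < e -> exists g : R -> R,
    [/\ measurable_fun [set: R] g, L1_translation_continuous g &
        (\int[mu]_t `|h t - g t|%:E <= e%:E)%E]) ->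
  L1_translation_continuous h.
Proof.
move=> mh happ e e0; have e30 : 0 < e / 3 by rewrite divr_gt0.
have [g [mg cg hg]] := happ _ e30.
have mhg : measurable_fun [set: R] (fun t => h t - g t).
  exact: measurable_funB.
have mhgs s : measurable_fun [set: R] (fun t => h (t + s) - g (t + s)).
  exact: (measurableT_comp mhg (measurable_shift s)).
near=> s.
under eq_integral => t _.
  have -> : h (t + s) - h t = (h (t + s) - g (t + s)) +
    ((g (t + s) - g t) + - (h t - g t)) by ring.
  over.
have -> : e = e / 3 + (e / 3 + e / 3) by field.
rewrite 2!EFinD.
apply: le_trans (integral_normD_le _ _) _ => //.
  apply: measurable_funD; first exact: measurable_fun_shiftB.
  exact: measurableT_comp.
apply: leeD.
  rewrite (ge0_integral_shift s (g := fun t => `|h t - g t|%:E))//.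
  by apply/measurable_EFinP; exact: measurableT_comp.
apply: le_trans (integral_normD_le _ _) _.
- exact: measurable_fun_shiftB.
- exact: measurableT_comp.
- apply: leeD; first by near: s; exact: cg.
  by under eq_integral do rewrite normrN.
Unshelve. all: by end_near. Qed.

(** Addition is continuous at each [(t, 0)] with [t] in [K]; compactness, in its near-covering form,
    makes the admissible range of [s] uniform in [t]. *)
Lemma compact_shift_subset_open (K U : set R) :
  compact K -> open U -> K `<=` U ->
  \forall s \near (0 : R), K `<=` (fun t => t + s) @^-1` U.
Proof.
move=> cK oU KU.
move/compact_near_coveringP : cK => /(_ R (nbhs 0) (fun s t => U (t + s))).
apply=> t Kt.
have : (fun z : R * R => z.1 + z.2) @ (t, 0 : R) --> t + 0.
  by apply: cvgD; [exact: cvg_fst|exact: cvg_snd].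
apply; rewrite addr0; apply: open_nbhs_nbhs; split => //; exact: KU.
Qed.

(** The integrand is nonzero only where exactly one of [t] and [t + s] is in [K]. For small [s] the
    other one is then in [U], an open set around [K] with [U] minus [K] of measure below [e / 2].
    Each of the two cases contributes at most that measure. *)
Lemma L1_translation_continuous_compact (K : set R) : compact K ->
  L1_translation_continuous \1_K.
Proof.
move=> cK e e0; have e20 : 0 < e / 2 by rewrite divr_gt0.
have mK := compact_measurable cK.
have [U [oU KU mUK]] :=
  lebesgue_regularity_outer mK (compact_finite_measure cK) e20.
have mU := open_measurable oU.
have mUK' : measurable (U `\` K) by exact: measurableD.
near=> s.
have KsU : K `<=` (fun t => t + s) @^-1` U.
  by near: s; exact: compact_shift_subset_open.
(* The opposite shift serves the case [t + s] in [K], where [t] is recovered as [(t + s) - s]. *)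
have KNsU : K `<=` (fun t => t - s) @^-1` U.
  near: s; apply: (nearN 0 (fun s => K `<=` (fun t => t + s) @^-1` U)).1.
  by rewrite oppr0; exact: compact_shift_subset_open.
have mI : measurable_fun [set: R] (fun t => (\1_(U `\` K) t)%:E : \bar R).
  exact/measurable_EFinP/measurable_indic.
apply: (@le_trans _ _ (\int[mu]_t
    ((\1_(U `\` K) t)%:E + (\1_(U `\` K) (t + s))%:E)))%E.
  apply: ge0_le_integral => //.
  - apply/measurable_EFinP; apply: measurableT_comp => //.
    by apply: measurable_fun_shiftB; exact: measurable_indic.
  - apply: emeasurable_funD => //.
    exact: (measurableT_comp mI (measurable_shift s)).
  - move=> t _; rewrite -EFinD lee_fin !indicE !in_setD.
    have [tK|tK] := boolP (t \in K); have [tsK|tsK] := boolP (t + s \in K);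
      rewrite ?subrr ?normr0 ?addr_ge0//=.
    + have -> : t + s \in U by rewrite inE; apply: KsU; rewrite -inE.
      by rewrite sub0r normrN normr1 lerDr.
    + have -> : t \in U.
        by rewrite inE -(addrK s t); apply: KNsU; rewrite -inE.
      by rewrite subr0 normr1 lerDl.
rewrite ge0_integralD//; last first.
  exact: (measurableT_comp mI (measurable_shift s)).
rewrite (ge0_integral_shift s mI)// integral_indic// setIT (splitr e) EFinD.
by apply: leeD; exact: ltW.
Unshelve. all: by end_near. Qed.

(** Inner regularity gives a compact [K] inside [A]; the L1 distance of the two indicators is the
    measure of [A] minus [K]. *)
Lemma L1_translation_continuous_indic (A : set R) : measurable A ->
  (mu A < +oo)%E -> L1_translation_continuous \1_A.
Proof.
move=> mA Aoo; apply: L1_translation_continuous_approx.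
  exact: measurable_indic.
move=> e e0; have [K [cK KA mAK]] := lebesgue_regularity_inner mA Aoo e0.
have mK := compact_measurable cK.
exists \1_K; split.
- exact: measurable_indic.
- exact: L1_translation_continuous_compact.
- apply: le_trans (ltW mAK).
  rewrite -[A `\` K]setIT -integral_indic//; last exact: measurableD.
  rewrite le_eqVlt; apply/orP; left; apply/eqP; apply: eq_integral => t _.
  rewrite !indicE in_setD; congr (_%:E).
  have [tK|tK] := boolP (t \in K); last by rewrite subr0 andbT ger0_norm.
  have -> : t \in A by rewrite inE; apply: KA; rewrite -inE.
  by rewrite subrr normr0.
Qed.

Lemma L1_translation_continuous_sum (n : nat) (F : 'I_n -> R -> R) :
  (forall i, measurable_fun [set: R] (F i)) ->
  (forall i, L1_translation_continuous (F i)) ->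
  L1_translation_continuous (fun t => \sum_(i < n) F i t).
Proof.
elim: n F => [|n IH] F mF cF.
  under [X in L1_translation_continuous X]eq_fun do rewrite big_ord0.
  exact: L1_translation_continuous0.
under [X in L1_translation_continuous X]eq_fun do rewrite big_ord_recl.
apply: L1_translation_continuousD => //; last exact: IH.
exact: measurable_sum.
Qed.

Import HBSimple.

(* [lebesgue_measure] lives on [measurableTypeR R], whose display differs from
   that of the default measurable structure on [R]; the two are convertible but
   do not unify, hence the type of [g]. *)
Lemma L1_translation_continuous_sfun (g : {sfun measurableTypeR R >-> R}) :
  mu.-integrable [set: R] (EFin \o g) -> L1_translation_continuous g.
Proof.
move=> ig.
have mA r : measurable (g @^-1` [set r]).
  exact: (measurable_funPTI g (measurable_set1 r)).
rewrite (funext (fimfunEord g)).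
apply: L1_translation_continuous_sum => i.
  by apply: measurable_funM => //; apply: measurable_indic; exact: mA.
set r := (X in (fun=> X * _)).
(* The level set of the value [0] may have infinite measure, so its term is treated apart. *)
have [->|r0] := eqVneq r 0.
  under [X in L1_translation_continuous X]eq_fun do rewrite mul0r.
  exact: L1_translation_continuous0.
apply: L1_translation_continuousZ; first by apply: measurable_indic; exact: mA.
apply: L1_translation_continuous_indic; first exact: mA.
have /integrableP[mg goo] := ig.
(* A Markov-type bound by the integral of the absolute value of [g]; as [r] is nonzero, it forces
   the level set to have finite measure. *)
have : (`|r|%:E * mu (g @^-1` [set r]) < +oo)%E.
  apply: le_lt_trans goo.
  rewrite -[g @^-1` _]setIT -integral_indic; [|by []|exact: mA].
  have mI : measurable_fun [set: R]
      (fun t => (\1_(g @^-1` [set r]) t)%:E : \bar R).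
    by apply/measurable_EFinP; apply: measurable_indic; exact: mA.
  rewrite -ge0_integralZl_EFin//.
  apply: ge0_le_integral => //.
  - exact: emeasurable_funM.
  - exact: measurableT_comp.
  move=> t _; rewrite /= -EFinM lee_fin indicE.
  have [|_] := boolP (t \in g @^-1` [set r]); last by rewrite mulr0.
  by rewrite inE /= => ->; rewrite mulr1.
have [//|] := ltP (mu (g @^-1` [set r])) +oo%E; rewrite leye_eq => /eqP ->.
by rewrite gt0_muley ?ltxx// lte_fin normr_gt0.
Qed.

Lemma integrable_L1_translation_continuous (f : R -> R) :
  mu.-integrable [set: R] (EFin \o f) -> L1_translation_continuous f.
Proof.
move=> fi; have /integrableP[/measurable_EFinP mf _] := fi.
apply: L1_translation_continuous_approx => // e e0.
have [g [gi _ fg]] := approximation_sfun_integrable measurableT fi.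
have [N _ HN] : \forall n \near \oo,
    (\int[mu]_z `|(EFin \o f) z - (g n z)%:E| <= e%:E)%E.
  (* The L1 distances converge to [0] in [\bar R], where the values at most [e] form a neighbourhood
     of [0]. *)
  apply: (fg [set x | x <= e%:E]%E).
  have := @open_ereal_lt' R 0%E e%:E; rewrite lte_fin => /(_ e0).
  by apply: filterS => x /ltW.
exists (g N); split.
- by have /measurable_int /measurable_EFinP := gi N.
- exact: L1_translation_continuous_sfun.
- exact: HN (leqnn N).
Qed.

(** * Convolution of a bounded function with an integrable one *)

Lemma integrable_bounded_mulr (phi f : R -> R) (M : R) :
  measurable_fun [set: R] phi -> (forall x, `|phi x| <= M) ->
  mu.-integrable [set: R] (EFin \o f) ->
  mu.-integrable [set: R] (EFin \o (fun t => phi t * f t)).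
Proof.
move=> mphi phiM fi; have /integrableP[/measurable_EFinP mf _] := fi.
apply: le_integrable (integrableZl measurableT M fi) => //.
  by apply/measurable_EFinP; exact: measurable_funM.
move=> t _; rewrite /= lee_fin !normrM ler_wpM2r//.
exact: le_trans (ler_norm _).
Qed.

Lemma integrable_shift (s : R) (f : R -> R) :
  mu.-integrable [set: R] (EFin \o f) ->
  mu.-integrable [set: R] (EFin \o (fun t => f (t + s))).
Proof.
move=> /integrableP[mf foo]; apply/integrableP; split.
  exact: (measurableT_comp mf (measurable_shift s)).
rewrite (ge0_integral_shift s (g := fun t => `|(EFin \o f) t|)%E)//.
exact: measurableT_comp.
Qed.

Lemma convolution_unif_continuous (phi f : R -> R) (M : R) :
  measurable_fun [set: R] phi -> (forall x, `|phi x| <= M) ->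
  mu.-integrable [set: R] (EFin \o f) ->
  unif_continuous (fun x => \int[mu]_t (phi (x - t) * f t)).
Proof.
move=> mphi phiM fi; have /integrableP[/measurable_EFinP mf _] := fi.
have M0 : 0 <= M by exact: le_trans (normr_ge0 _) (phiM 0).
have mphix x : measurable_fun [set: R] (fun t => phi (x - t)).
  by apply: measurableT_comp => //; exact: measurable_funB.
apply/unif_continuousP => e e0.
(* Since [M] may be [0], division is by [M + 1]; the final bound [M * (e / (M + 1))] is then
   strictly below [e]. *)
have M10 : 0 < M + 1 by rewrite ltr_wpDl.
have eM0 : 0 < e / (M + 1) by rewrite divr_gt0.
have [d /= d0 dP] := integrable_L1_translation_continuous fi eM0.
exists d => // -[x z] /= xz.
have {dP} := dP (z - x); rewrite /= sub0r normrN distrC => /(_ xz) xzP.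
(* Replacing [t] by [t + (z - x)] moves the increment from [phi], which need not be continuous, onto
   [f]. *)
have -> : \int[mu]_t (phi (z - t) * f t) =
    \int[mu]_t (phi (x - t) * f (t + (z - x))).
  rewrite /Rintegral -(integral_shift (z - x)); last first.
    by apply/measurable_EFinP; exact: measurable_funM.
  congr fine; apply: eq_integral => t _; congr (phi _ * _)%:E.
  by ring.
have phifi g : mu.-integrable [set: R] (EFin \o g) ->
    mu.-integrable [set: R] (EFin \o (fun t => phi (x - t) * g t)).
  by apply: (integrable_bounded_mulr (M := M)).
have fsi := integrable_shift (z - x) fi.
rewrite -ball_normE /= distrC -RintegralB//; [|exact: phifi|exact: phifi].
under eq_Rintegral do rewrite -mulrBr.
have mfs := measurable_fun_shiftB (z - x) mf.
have mphifs : measurable_fun [set: R]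
    (fun t => phi (x - t) * (f (t + (z - x)) - f t)) by exact: measurable_funM.
rewrite -lte_fin EFin_normr_Rintegral//; last first.
  apply: phifi; under [X in _.-integrable _ X]eq_fun do rewrite /= EFinB.
  exact: integrableB.
apply: (@le_lt_trans _ _ (M%:E * (e / (M + 1))%:E)%E).
  apply: le_trans (lee_pmul _ _ (lexx _) xzP); last 2 first.
  - by rewrite lee_fin.
  - exact: integral_ge0.
  rewrite -ge0_integralZl_EFin//; last exact: measurable_fun_EFin_norm.
  apply: le_trans (le_abse_integral _ _ _) _ => //.
    exact/measurable_EFinP.
  apply: ge0_le_integral => //.
  - exact: measurable_fun_EFin_norm.
  - by apply: emeasurable_funM => //; exact: measurable_fun_EFin_norm.
  - move=> t _; rewrite /= -EFinM lee_fin normrM ler_wpM2r//.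
rewrite -EFinM lte_fin mulrCA gtr_pMr//.
by rewrite ltr_pdivrMr// mul1r ltrDl.
Qed.

End translation.

(** * Measurability and boundedness of [varphi] *)

Lemma measurable_integral_snd d1 d2 (T1 : measurableType d1)
    (T2 : measurableType d2) (R : realType)
    (m : {sigma_finite_measure set T2 -> \bar R}) (f : T1 * T2 -> \bar R) :
  measurable_fun [set: T1 * T2] f ->
  measurable_fun [set: T1] (fun x => \int[m]_y f (x, y))%E.
Proof.
move=> mf; under eq_fun do rewrite integralE.
(* Tonelli covers nonnegative functions, hence the positive and negative parts separately. *)
apply: emeasurable_funB.
  under eq_fun => x do rewrite (funepos_comp f (pair x)).
  exact: (measurable_fun_fubini_tonelli_F _
  (measurable_funepos mf) (funepos_ge0 f)).
under eq_fun => x do rewrite (funeneg_comp f (pair x)).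
exact: (measurable_fun_fubini_tonelli_F _
  (measurable_funeneg mf) (funeneg_ge0 f)).
Qed.

Section varphi.
Context d (T : measurableType d) (R : realType) (P : probability T R).
Variables (alpha gamma : {RV P >-> R}) (y : R -> R).
Hypothesis my : measurable_fun [set: R] y.

(** An expectation depending on [x] is a partial integral of a jointly measurable function on
    [R * T]. *)
Lemma measurable_varphi : measurable_fun [set: R] (varphi alpha gamma y).
Proof.
rewrite /varphi unlock; apply: measurableT_comp => //.
pose g (xw : R * T) := (y (alpha xw.2 * (xw.1 - gamma xw.2)))%:E.
suff mg : measurable_fun [set: R * T] g.
  exact: (measurable_integral_snd P mg).
apply/measurable_EFinP; apply: measurableT_comp => //.
apply: measurable_funM; first exact: measurableT_comp.
by apply: measurable_funB => //; exact: measurableT_comp.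
Qed.

Lemma varphi_le (M : R) : (forall x, `|y x| <= M) ->
  forall x, `|varphi alpha gamma y x| <= M.
Proof.
move=> yM x; have M0 : 0 <= M by exact: le_trans (normr_ge0 _) (yM 0).
rewrite /varphi unlock.
set g := (fun w => _).
have mg : measurable_fun [set: T] g.
  apply/measurable_EFinP; apply: measurableT_comp => //.
  by apply: measurable_funM => //; exact: measurable_funB.
have : (`|\int[P]_w g w| <= M%:E)%E.
  apply: le_trans (le_abse_integral _ _ mg) _ => //.
  apply: le_trans (integral_le_bound (M%:E) _ mg _ _) _ => //.
    by apply: aeW => w _; rewrite lee_fin.
  by rewrite [X in (_ * X)%E](probability_setT P) mule1.
(* The bound rules out infinite values, so [fine] loses nothing. *)
by case: integral => //= r; rewrite lee_fin.
Qed.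

End varphi.

Theorem theorem3p4 (d : measure_display) (T : measurableType d) (R : realType)
    (P : probability T R) (alpha gamma xi : {RV P >-> R}) (f_xi : R -> R)
    (indep : independent_rv P (fun w => (alpha w, gamma w)) xi)
    (dens : has_density xi f_xi)
    (alpha_neq0 : P [set w | alpha w != 0] = 1%E)
    (alpha_neq1 : (0 < P [set w | `|alpha w| != 1]%R)%E)
    (nondeg : let beta := fun w => gamma w + xi w in
      ~ exists c : R, {ae P, forall w, alpha w * (c - beta w) = c})
    (y : R -> R) (ysol : bounded_solution alpha gamma f_xi y) :
  unif_continuous y.
Proof.
have [my [M [_ yM]] yE] := ysol; have [mf f0 fE] := dens.
(* Boundedness supplies as bounds only the numbers strictly above [M]. *)
have {}yM x : `|y x| <= `|M| + 1.
  by apply: yM => //; rewrite ltr_pwDr// ler_norm.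
rewrite (funext yE).
apply: (convolution_unif_continuous (M := `|M| + 1)).
- exact: measurable_varphi.
- exact: varphi_le.
(* The density is integrable: it is nonnegative, and its integral is the total mass of the
   distribution of [xi]. *)
apply/integrableP; split; first exact/measurable_EFinP.
under eq_integral => t _ do rewrite /= ger0_norm//.
by rewrite -fE// probability_setT ltry.
Qed.
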